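(* In the pricing problem, if $y(z)$ is linear and non-increasing, and $\epsilon$ and $Z$ are non-positively correlated and jointly normal, then $$1-\left(\frac{\mathbb{E}[Y]}{y_0}\right)^2\;\le\;\frac{R(\tilde z)}{R(z^\star)}\;\le\;1 .$$
   Context: The pricing problem: there is a procurement cost $c>0$, the set of feasible prices is $\mathcal{Z}=(c,\infty)$, and $r(z)=z-c$. For each price $z$, the random variable $Y(z)$ is the demand that would be observed at price $z$ (so $Y(\cdot)$ is the random demand curve), and $y(z)=\mathbb{E}[Y(z)]$ is the mean demand curve; ''linear'' means of the form $a+bz$ with constants $a,b$. The random variable $Z$ is the historical price, and $Y=Y(Z)$ is the observed demand. Define $\tilde y(z)=\mathbb{E}[Y\mid Z=z]$, $R(z)=r(z)\,y(z)$ and $\tilde R(z)=r(z)\,\tilde y(z)$. Let $z^\star\in\arg\max_{z\in\mathcal{Z}}R(z)$ be an optimal price and $\tilde z\in\arg\max_{z\in\mathcal{Z}}\tilde R(z)$ be the price chosen by the predictive approach. Let $\epsilon(z)=Y(z)-y(z)$ and $\epsilon=\epsilon(Z)=Y-y(Z)$. The size of the market is $y_0=\sup_{z\in\mathcal{Z}}y(z)$.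
   Formalization: The formal theorem additionally assumes E[ε]=0 for ε=ε(Z), without which the lower bound can fail; it also takes Var Z>0, y_0≠0 and the version of E[Y|Z=z] continuous on (c,∞), so that the named quantities are well defined. *)

(* Defs.v *)
From HB Require Import structures.
From mathcomp Require Export all_boot all_order all_algebra.
From mathcomp Require Export all_classical all_reals all_analysis.

Set Implicit Arguments.
Unset Strict Implicit.
Unset Printing Implicit Defensive.

Import Order.TTheory GRing.Theory Num.Theory.
Import numFieldNormedType.Exports.

Local Open Scope classical_set_scope.
Local Open Scope ring_scope.

Definition is_argmax (R : realType) (D : set R) (f : R -> R) (x : R) : Prop :=
  D x /\ forall u, D u -> f u <= f x.

Definition affine_fun (R : realType) (f : R -> R) : Prop :=
  exists a b : R, forall z, f z = a + b * z.

Definition feasible (R : realType) (c : R) : set R := [set z | c < z].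

Definition revenue (R : realType) (c : R) (f : R -> R) (z : R) : R :=
  (z - c) * f z.

(* [Y z] is the demand at price [z], [Z] the historical price.  Prices range
   over all of [R], not only over [feasible c], because a nondegenerate normal
   [Z] charges every interval. *)
Section pricing.
Context (d : measure_display) (T : measurableType d) (R : realType).
Context (P : probability T R).

Definition mean_demand (Y : R -> {RV P >-> R}) (z : R) : R := fine 'E_P[Y z].

Definition observed_demand (Y : R -> {RV P >-> R}) (Z : {RV P >-> R})
  : T -> R := fun w => Y (Z w) w.

Definition residual (Y : R -> {RV P >-> R}) (Z : {RV P >-> R}) : T -> R :=
  fun w => observed_demand Y Z w - mean_demand Y (Z w).

Definition market_size (Y : R -> {RV P >-> R}) (c : R) : R :=
  sup [set mean_demand Y z | z in feasible c].

(* [g z] is a version of [E[X | Z = z]], hence pinned down only up to a null set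
   of the law of [Z]: pointwise statements about [g] need a regularity
   condition such as continuity. *)
Definition cond_expectation_version (X : T -> R) (Z : {RV P >-> R})
    (g : R -> R) : Prop :=
  [/\ measurable_fun setT g,
      P.-integrable setT (EFin \o (g \o Z)) &
      forall B : set R, measurable B ->
        (\int[P]_(w in Z @^-1` B) (X w)%:E
         = \int[P]_(w in Z @^-1` B) (g (Z w))%:E)%E].

(* The law of [(U, V)] is that of [m + A G] with [G] standard normal on the
   plane; [A] may be singular.  Scaling by [A] avoids [normal_prob _ 0], which is
   not a Dirac mass. *)
Definition jointly_normal (U V : T -> R) : Prop :=
  [/\ measurable_fun setT U, measurable_fun setT V &
      exists m1 m2 a11 a12 a21 a22 : R,
        forall B : set (R * R), measurable B ->
          P [set w | B (U w, V w)]
          = (normal_prob 0 1 \x normal_prob 0 1)%E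
              [set g : R * R | B (m1 + a11 * g.1 + a12 * g.2,
                                  m2 + a21 * g.1 + a22 * g.2)]].

End pricing.

(* Main.v *)
Require Import Defs.
From mathcomp Require Import all_boot all_order all_algebra.
From mathcomp Require Import all_classical all_reals all_analysis.
From mathcomp Require Import ring lra.
From mathcomp Require Import measurable_realfun.

(** The residual and the price being jointly normal, the regression of the
    residual on the price is linear: E[eps | Z] = beta (Z - m), where m = E[Z]
    and beta = Cov(eps, Z) / Var(Z) <= 0 ([jointly_normal_regression]).
    Writing y(z) = a + b z, the predictive curve is therefore
    a + b z + beta (z - m), at first only almost surely in the law of Z.
    That law charges every interval, so continuity upgrades the
    equality to every price z > c ([continuous_eq0_of_integral_eq0]).

    Both revenues are then quadratic in the margin u = z - c, namely
    u (y0 + b u) and u (y0 - beta (m - c) + (b + beta) u), with y0 = a + b c the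
    market size.  As y0 is nonzero, the existence of an optimal price forces b < 0
    and y0 > 0, and both prices have a closed form ([argmax_concave_quadratic]).  Since
    u (y0 + b u) divided by its maximum is 1 - ((y0 + 2 b u) / y0) ^ 2, the
    revenue ratio is exactly

      1 - (beta / (b + beta) * (E[Y] / y0)) ^ 2

    ([linear_revenue_ratio]), and 0 <= beta / (b + beta) <= 1 because b and
    beta are both nonpositive.

    The regression formula rests on a symmetry of the standard normal law on the
    plane.  There Z - m and W = eps - beta (Z - m) are orthogonal linear
    forms, hence the reflection that fixes the form Z - m changes the sign of W;
    the law being invariant under reflections, E[W h(Z)] = -E[W h(Z)] = 0 for
    every h that makes the product integrable ([integral_orthogonal]).  To see the
    invariance, factor the reflection into shears and a flip along one coordinate:
    each of them acts on every line parallel to one axis by x -> t + x or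
    x -> t - x, hence preserves the planar Lebesgue measure by Tonelli, and the
    Gaussian density is radial ([normal_prob2_reflect2]). *)

Set Implicit Arguments.
Unset Strict Implicit.
Unset Printing Implicit Defensive.

Import Order.TTheory GRing.Theory Num.Theory.
Import numFieldNormedType.Exports.

Local Open Scope classical_set_scope.
Local Open Scope ring_scope.

(** * Vanishing integrals and equality in law *)

Lemma null_of_integral_pos_eq0 (d : measure_display) (T : measurableType d)
    (R : realType) (mu : {measure set T -> \bar R}) (A : set T) (f : T -> R) :
  measurable A -> measurable_fun A f -> (forall x, A x -> 0 < f x) ->
  (\int[mu]_(x in A) (f x)%:E = 0)%E -> mu A = 0%E.
Proof.
move=> mA mf f_gt0 intf0.
have mEf : measurable_fun A (EFin \o f) by apply/measurable_EFinP.
have : (\int[mu]_(x in A) `|(EFin \o f) x| = 0)%E.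
  rewrite -[RHS]intf0; apply: eq_integral => x /[!inE] Ax.
  by rewrite /= ger0_norm// ltW// f_gt0.
move/(ae_eq_integral_abs mu mA mEf) => [N [mN N0 sub]].
apply: (subset_measure0 _ mN _ N0) => // x Ax; apply: sub => /= /(_ Ax).
by move=> [] fx0; have := f_gt0 x Ax; rewrite fx0 ltxx.
Qed.

(** Transfer of integrability and of the integral between two random elements
    with the same law; they may live on different spaces.  It serves both to
    compute under joint normality and to use a symmetry of a law. *)
Lemma same_law_integral (d1 d2 d : measure_display) (T1 : measurableType d1)
    (T2 : measurableType d2) (T : measurableType d) (R : realType)
    (mu1 : {measure set T1 -> \bar R}) (mu2 : {measure set T2 -> \bar R})
    (X1 : T1 -> T) (X2 : T2 -> T) (f : T -> R) :
  measurable_fun setT X1 -> measurable_fun setT X2 ->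
  (forall B, measurable B -> mu1 (X1 @^-1` B) = mu2 (X2 @^-1` B)) ->
  measurable_fun setT f ->
  mu2.-integrable setT (EFin \o (f \o X2)) ->
  mu1.-integrable setT (EFin \o (f \o X1)) /\
  (\int[mu1]_x (f (X1 x))%:E = \int[mu2]_x (f (X2 x))%:E)%E.
Proof.
move=> mX1 mX2 law mf intf.
have mEf : measurable_fun setT (EFin \o f) by apply/measurable_EFinP.
have intf1 : mu1.-integrable setT (EFin \o (f \o X1)).
  apply/integrableP; split.
    by apply/measurable_EFinP; exact: measurableT_comp.
  move/integrableP : intf => [_]; apply: le_lt_trans.
  have mnf : measurable_fun setT (fun t => `|(f t)%:E|%E).
    exact: measurableT_comp.
  rewrite le_eqVlt; apply/orP; left; apply/eqP.
  rewrite -[LHS](@ge0_integral_pushforward _ _ _ _ _ X1 mX1 mu1 setT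
    (fun t => `|(f t)%:E|%E))//.
  rewrite -[RHS](@ge0_integral_pushforward _ _ _ _ _ X2 mX2 mu2 setT
    (fun t => `|(f t)%:E|%E))//.
  by apply: eq_measure_integral => A mA _; exact: law.
split=> //.
rewrite -[LHS](@integral_pushforward _ _ _ _ _ X1 mX1 mu1 setT (EFin \o f))//.
rewrite -[RHS](@integral_pushforward _ _ _ _ _ X2 mX2 mu2 setT (EFin \o f))//.
by apply: eq_measure_integral => A mA _; exact: law.
Qed.

(** * Integrals against Lebesgue and normal measures on the line *)

Section lebesgue.
Context {R : realType}.
Local Notation mu := (@lebesgue_measure R).
Local Open Scope ereal_scope.

Lemma lebesgue_measure_shift (t : R) (A : set R) : measurable A ->
  mu ((fun x => (x + t)%R) @^-1` A) = mu A.
Proof.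
move=> mA; apply/esym.
have mS : measurable_fun setT ((fun x => (x + t)%R) : measurableTypeR R -> measurableTypeR R).
  exact: measurable_funD.
apply: (lebesgue_measure_unique
  (mu := pushforward mu
    ((fun x => (x + t)%R) : measurableTypeR R -> measurableTypeR R))) => //.
move=> _ [[a b]] _ <-/=.
transitivity (mu `](a - t)%R, (b - t)%R]%classic); last first.
  congr (mu _).
  by apply/seteqP; split => x /=; rewrite !in_itv/= ltrBlDr lerBrDr.
rewrite !lebesgue_measure_itv/= !lte_fin ltrD2r; case: ifP => // _.
by rewrite -!EFinD; congr EFin; ring.
Qed.

Lemma ge0_integral_shift (t : R) (f : R -> \bar R) :
  measurable_fun setT f -> (forall x, 0 <= f x) ->
  \int[mu]_x f (x + t)%R = \int[mu]_x f x.
Proof.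
move=> mf f0.
have mS : measurable_fun setT ((fun x => (x + t)%R) : measurableTypeR R -> measurableTypeR R).
  exact: measurable_funD.
rewrite -[LHS](ge0_integral_pushforward mS _ measurableT)//.
by apply: eq_measure_integral => A mA _; exact: lebesgue_measure_shift.
Qed.

Lemma ge0_integral_flip (t : R) (f : R -> \bar R) :
  measurable_fun setT f -> (forall x, 0 <= f x) ->
  \int[mu]_x f (t - x)%R = \int[mu]_x f x.
Proof.
move=> mf f0; rewrite -(ge0_integral_shift t mf)//.
have mS : measurable_fun setT (-%R : measurableTypeR R -> measurableTypeR R) by [].
pose g (x : R) := f (x + t)%R.
have mg : measurable_fun setT g.
  by apply: measurableT_comp => //; exact: measurable_funD.
transitivity (\int[pushforward mu (-%R : measurableTypeR R -> measurableTypeR R)]_x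
    g x).
  rewrite (ge0_integral_pushforward mS _ measurableT)//.
    by apply: eq_integral => x _ /=; rewrite /g addrC.
  by move=> x _; exact: f0.
rewrite -[RHS]/(\int[mu]_x g x).
by apply: eq_measure_integral => A mA _; exact: lebesgue_measureN.
Qed.

(** The normal law is given only by its values on sets; its Radon-Nikodym
    derivative agrees almost everywhere with the density that defines it. *)
Lemma ge0_integral_normal_prob (m s : R) (f : R -> \bar R) :
  measurable_fun setT f -> (forall x, 0 <= f x) ->
  \int[normal_prob m s]_x f x = \int[mu]_x (f x * (normal_pdf m s x)%:E).
Proof.
move=> mf f0.
have dom : normal_prob m s `<< mu := normal_prob_dominates m s.
rewrite -(Radon_Nikodym_SigmaFinite.change_of_variables dom)//.
have mRN : measurable_fun setT (Radon_Nikodym_SigmaFinite.f (normal_prob m s) mu).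
  exact: measurable_int (Radon_Nikodym_SigmaFinite.f_integrable dom).
have mpdf : measurable_fun setT (fun x => (normal_pdf m s x)%:E).
  by apply/measurable_EFinP; exact: measurable_normal_pdf.
apply: ae_eq_integral => //; try exact: emeasurable_funM.
apply: ae_eqe_mul2l; apply: integral_ae_eq => //.
  exact: Radon_Nikodym_SigmaFinite.f_integrable.
by move=> E _ mE; rewrite -Radon_Nikodym_SigmaFinite.f_integral.
Qed.

End lebesgue.

(** * Reflections preserve the standard normal law of the plane *)

Section plane.
Context {R : realType}.
Local Notation mu := (@lebesgue_measure R).
Local Notation N01 := (normal_prob (0 : R) 1).
Local Notation phi := (normal_pdf (0 : R) 1).
Local Open Scope ereal_scope.

Implicit Types f : R * R -> \bar R.

(** On each horizontal line the shear is a translation. *)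
Lemma ge0_integral_shear (t : R) f : measurable_fun setT f -> (forall z, 0 <= f z) ->
  \int[mu \x mu]_z f (z.1 + t * z.2, z.2)%R = \int[mu \x mu]_z f z.
Proof.
move=> mf f0.
have mS : measurable_fun setT (fun z : R * R => (z.1 + t * z.2, z.2)%R).
  apply: measurable_fun_pair => //; apply: measurable_funD => //.
  exact: measurable_funM.
rewrite !fubini_tonelli2//; last exact: measurableT_comp mS.
apply: eq_integral => y _; rewrite /fubini_G/=.
have mfy : measurable_fun setT (fun x : R => f (x, y)).
  exact: measurableT_comp.
exact: (@ge0_integral_shift _ (t * y)%R (fun x => f (x, y))).
Qed.

Lemma ge0_integral_flip_shear (q : R) f : measurable_fun setT f -> (forall z, 0 <= f z) ->
  \int[mu \x mu]_z f (z.1, q * z.1 - z.2)%R = \int[mu \x mu]_z f z.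
Proof.
move=> mf f0.
have mS : measurable_fun setT (fun z : R * R => (z.1, q * z.1 - z.2)%R).
  apply: measurable_fun_pair => //; apply: measurable_funB => //.
  exact: measurable_funM.
rewrite !fubini_tonelli1//; last exact: measurableT_comp mS.
apply: eq_integral => x _; rewrite /fubini_F/=.
have mfx : measurable_fun setT (fun y : R => f (x, y)).
  exact: measurableT_comp.
exact: (@ge0_integral_flip _ (q * x)%R (fun y => f (x, y))).
Qed.

Lemma ge0_integral_opp1 f : measurable_fun setT f -> (forall z, 0 <= f z) ->
  \int[mu \x mu]_z f (- z.1, z.2)%R = \int[mu \x mu]_z f z.
Proof.
move=> mf f0.
have mS : measurable_fun setT (fun z : R * R => (- z.1, z.2)%R).
  by apply: measurable_fun_pair => //; apply: measurableT_comp.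
rewrite !fubini_tonelli2//; last exact: measurableT_comp mS.
apply: eq_integral => y _; rewrite /fubini_G/=.
have mfy : measurable_fun setT (fun x : R => f (x, y)).
  exact: measurableT_comp.
rewrite -(@ge0_integral_flip _ 0%R (fun x => f (x, y)))//.
by apply: eq_integral => x _; rewrite sub0r.
Qed.

(** For p = cos(2 t) and q = sin(2 t), the reflection across the line through the
    origin at angle t. *)
Definition reflect2 (p q : R) (z : R * R) : R * R :=
  (p * z.1 + q * z.2, q * z.1 - p * z.2)%R.

Lemma measurable_reflect2 p q : measurable_fun setT (reflect2 p q).
Proof.
apply: measurable_fun_pair.
  by apply: measurable_funD => //; exact: measurable_funM.
by apply: measurable_funB => //; exact: measurable_funM.
Qed.

(** With t = (p - 1) / q and S_t the shear (x, y) -> (x + t y, y), the reflection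
    is S_t D S_(-t) where D : (x, y) -> (x, q x - y) acts on vertical lines by
    y -> q x - y.  When q = 0 only the two coordinate reflections remain. *)
Lemma ge0_integral_reflect2 (p q : R) f : (p ^+ 2 + q ^+ 2 = 1)%R ->
  measurable_fun setT f -> (forall z, 0 <= f z) ->
  \int[mu \x mu]_z f (reflect2 p q z) = \int[mu \x mu]_z f z.
Proof.
move=> pq1 mf f0.
have [q0|q0] := eqVneq q 0%R.
  have : (p == 1)%R || (p == -1)%R by rewrite -sqrf_eq1 -pq1 q0 expr0n/= addr0.
  case/orP => /eqP p1.
    rewrite -(ge0_integral_flip_shear 0 mf f0); apply: eq_integral => z _.
    by congr f; rewrite /reflect2 p1 q0; congr pair; ring.
  rewrite -(ge0_integral_opp1 mf f0); apply: eq_integral => z _.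
  by congr f; rewrite /reflect2 p1 q0; congr pair; ring.
pose t := ((p - 1) / q)%R.
pose S (t : R) (z : R * R) := (z.1 + t * z.2, z.2)%R.
pose D (z : R * R) := (z.1, q * z.1 - z.2)%R.
have mS s : measurable_fun setT (S s).
  apply: measurable_fun_pair => //; apply: measurable_funD => //.
  exact: measurable_funM.
have mD : measurable_fun setT D.
  apply: measurable_fun_pair => //; apply: measurable_funB => //.
  exact: measurable_funM.
have MS z : reflect2 p q z = S t (D (S (- t)%R z)).
  rewrite /reflect2 /S /D /= /t; congr pair.
    apply: (mulfI q0); transitivity (q * (p * z.1) + (1 - p ^+ 2) * z.2)%R.
      by rewrite -pq1; ring.
    by field.
  by field.
have mfS : measurable_fun setT (f \o S t) by exact: measurableT_comp.
have mfSD : measurable_fun setT (f \o S t \o D) by exact: measurableT_comp.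
under eq_integral do rewrite MS.
rewrite (ge0_integral_shear (- t)%R mfSD)//; last by move=> z /=.
rewrite (ge0_integral_flip_shear q mfS)//; last by move=> z /=.
exact: ge0_integral_shear.
Qed.

Lemma normal_prob2E (A : set (R * R)) : measurable A ->
  (N01 \x N01) A = \int[mu \x mu]_z ((\1_A z)%:E * (phi z.1 * phi z.2)%:E).
Proof.
move=> mA.
have mphi : measurable_fun setT phi := measurable_normal_pdf 0 1.
have m1A : measurable_fun setT (fun z => (\1_A z : R)%:E).
  by apply/measurable_EFinP; exact: measurable_indic.
have mphi2 : measurable_fun setT (fun z : R * R => (phi z.1 * phi z.2)%:E).
  apply/measurable_EFinP; apply: measurable_funM; exact: measurableT_comp.
have mi x : measurable_fun setT (fun y : R => (\1_A (x, y) : R)%:E).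
  exact: measurableT_comp m1A _.
rewrite -[A in LHS]setIT -integral_indic// fubini_tonelli1//.
rewrite fubini_tonelli1; first last.
- by move=> z; rewrite mule_ge0// lee_fin// mulr_ge0// normal_pdf_ge0.
- exact: emeasurable_funM.
rewrite ge0_integral_normal_prob; first last.
- by move=> x; apply: integral_ge0 => y _; rewrite lee_fin.
- exact: measurable_fun_fubini_tonelli_F.
apply: eq_integral => x _; rewrite /fubini_F/=.
rewrite ge0_integral_normal_prob//.
rewrite -ge0_integralZr//; first last.
- by rewrite lee_fin normal_pdf_ge0.
- by move=> y _; rewrite mule_ge0// lee_fin// normal_pdf_ge0.
- by apply: emeasurable_funM; [exact: mi|exact/measurable_EFinP].
by apply: eq_integral => y _; rewrite -!EFinM; congr EFin; ring.
Qed.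

Lemma normal_prob2_reflect2 (p q : R) (A : set (R * R)) :
  (p ^+ 2 + q ^+ 2 = 1)%R -> measurable A ->
  (N01 \x N01) (reflect2 p q @^-1` A) = (N01 \x N01) A.
Proof.
move=> pq1 mA.
have mphi : measurable_fun setT phi := measurable_normal_pdf 0 1.
have mrA : measurable (reflect2 p q @^-1` A).
  by rewrite -[X in measurable X]setTI; exact: measurable_reflect2.
rewrite !normal_prob2E// -[RHS](ge0_integral_reflect2 pq1); first last.
- by move=> z; rewrite mule_ge0// lee_fin// mulr_ge0// normal_pdf_ge0.
- apply: emeasurable_funM; apply/measurable_EFinP; first exact: measurable_indic.
  by apply: measurable_funM; exact: measurableT_comp.
apply: eq_integral => z _; congr (_ * _%:E).
have phiE x : phi x = (normal_peak 1 * expR (- x ^+ 2 / (1 ^+ 2 *+ 2)))%R.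
  by rewrite normal_pdfE ?oner_neq0// /normal_fun subr0.
have phi2E x y : (phi x * phi y =
    normal_peak 1 ^+ 2 * expR (- (x ^+ 2 + y ^+ 2) / (1 ^+ 2 *+ 2)))%R.
  by rewrite !phiE mulrACA -expRD; congr (_ * expR _)%R; rewrite -mulrDl opprD.
have norm_r : ((reflect2 p q z).1 ^+ 2 + (reflect2 p q z).2 ^+ 2 =
    z.1 ^+ 2 + z.2 ^+ 2 :> R)%R.
  rewrite -[RHS]mul1r -pq1 /reflect2; case: z => x y; cbn [fst snd]; ring.
by rewrite !phi2E norm_r.
Qed.

End plane.

(** * Moments, odd functions and strips under the standard normal law *)

Section moments.
Context {R : realType}.
Local Notation mu := (@lebesgue_measure R).
Local Notation N01 := (normal_prob (0 : R) 1).
Local Notation N2 := (N01 \x N01)%E.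

Lemma integrable_sqr_normal01 : N01.-integrable setT (fun x : R => (x ^+ 2)%:E).
Proof.
have mx2 : measurable_fun setT (fun x : R => (x ^+ 2)%:E).
  by apply/measurable_EFinP; exact: measurable_funX.
apply/integrableP; split => //.
have mpdf2 : measurable_fun setT (fun x : R => (normal_pdf 0 2 x)%:E).
  by apply/measurable_EFinP; exact: measurable_normal_pdf.
(* With t = 3 x^2 / 8 the inequality t <= exp t gives
     x^2 exp (- x^2 / 2) <= 8 / 3 exp (- x^2 / 8),
   and the right-hand side is a multiple of the density of standard deviation 2. *)
pose C : R := 8 / 3 * (normal_peak 1 / normal_peak 2).
have two_neq0 : 2 != 0 :> R by rewrite pnatr_eq0.
have p2 : 0 < normal_peak 2 :> R by exact: normal_peak_gt0.
have C0 : 0 <= C by rewrite !mulr_ge0 ?invr_ge0 ?normal_peak_ge0.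
rewrite ge0_integral_normal_prob//; last exact: measurableT_comp.
apply: (@le_lt_trans _ _ (\int[mu]_x (C%:E * (normal_pdf 0 2 x)%:E))%E).
  apply: ge0_le_integral => //.
  - by move=> x _; rewrite mule_ge0// lee_fin normal_pdf_ge0.
  - apply: emeasurable_funM; first exact: measurableT_comp.
    by apply/measurable_EFinP; exact: measurable_normal_pdf.
  - exact: emeasurable_funM.
  move=> x _; rewrite /= -!EFinM lee_fin ger0_norm ?sqr_ge0//.
  have pdf1 : normal_pdf 0 1 x = normal_peak 1 * expR (- (x ^+ 2 / 2)).
    rewrite normal_pdfE ?oner_neq0// /normal_fun subr0 expr1n mulNr.
    by congr (_ * expR (- (_ / _))).
  have pdf2 : normal_pdf 0 2 x = normal_peak 2 * expR (- (x ^+ 2 / 8)).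
    rewrite normal_pdfE// /normal_fun subr0 mulNr.
    by congr (_ * expR (- (_ / _))); ring.
  rewrite pdf1 pdf2 /C.
  have -> : - (x ^+ 2 / 2) = - (3 * x ^+ 2 / 8) + - (x ^+ 2 / 8) by field.
  rewrite expRD expRN.
  have := expR_ge1Dx (3 * x ^+ 2 / 8); set t := 3 * x ^+ 2 / 8 => et.
  have et0 := expR_gt0 t.
  have le83 : x ^+ 2 / expR t <= 8 / 3.
    by rewrite ler_pdivrMr//; move: et; rewrite /t; lra.
  have -> : 8 / 3 * (normal_peak 1 / normal_peak 2) *
      (normal_peak 2 * expR (- (x ^+ 2 / 8))) =
      8 / 3 * (normal_peak 1 * expR (- (x ^+ 2 / 8))).
    by field; rewrite gt_eqF.
  have -> : x ^+ 2 * (normal_peak 1 * ((expR t)^-1 * expR (- (x ^+ 2 / 8)))) =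
     x ^+ 2 / expR t * (normal_peak 1 * expR (- (x ^+ 2 / 8))) by ring.
  by rewrite ler_wpM2r// mulr_ge0 ?normal_peak_ge0 ?expR_ge0.
rewrite ge0_integralZl//; last by move=> x _; rewrite lee_fin normal_pdf_ge0.
by rewrite integral_normal_pdf mule1 ltry.
Qed.

Lemma normal_prob2_setT : N2 [set: R * R] = 1%E.
Proof.
rewrite -setXTT; transitivity (N01 setT * N01 setT)%E.
  exact: product_measure1E.
by rewrite probability_setT mule1.
Qed.

(** Each coordinate has the one-dimensional law, and
    (m + a x + b y)^2 <= 3 (m^2 + a^2 x^2 + b^2 y^2). *)
Lemma integrable_sqr_plane (m a b : R) :
  N2.-integrable setT (fun z : R * R => ((m + a * z.1 + b * z.2) ^+ 2)%:E).
Proof.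
have mf : measurable_fun setT (fun x : R => x ^+ 2) by exact: measurable_funX.
have [int1 _] : N2.-integrable setT (EFin \o ((fun x : R => x ^+ 2) \o fst)) /\
    (\int[N2]_z ((z.1 : R) ^+ 2)%:E = \int[N01]_x (x ^+ 2)%:E)%E.
  apply: (@same_law_integral _ _ _ _ _ _ R N2 N01 fst id) => //.
    move=> B mB; rewrite -setXT.
    transitivity (N01 B * N01 setT)%E; first exact: product_measure1E.
    by rewrite probability_setT mule1.
  exact: integrable_sqr_normal01.
have [int2 _] : N2.-integrable setT (EFin \o ((fun x : R => x ^+ 2) \o snd)) /\
    (\int[N2]_z ((z.2 : R) ^+ 2)%:E = \int[N01]_x (x ^+ 2)%:E)%E.
  apply: (@same_law_integral _ _ _ _ _ _ R N2 N01 snd id) => //.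
    move=> B mB; rewrite -setTX.
    transitivity (N01 setT * N01 B)%E; first exact: product_measure1E.
    by rewrite probability_setT mul1e.
  exact: integrable_sqr_normal01.
have intb : N2.-integrable setT (fun z : R * R =>
    ((3 * m ^+ 2)%:E + ((3 * a ^+ 2)%:E * (z.1 ^+ 2)%:E +
     (3 * b ^+ 2)%:E * (z.2 ^+ 2)%:E))%E).
  apply: integrableD => //; last apply: integrableD => //.
  - apply/integrableP; split=> //.
    by rewrite integral_cst// [X in (_ * X)%E]normal_prob2_setT mule1 ltry.
  - exact: integrableZl.
  - exact: integrableZl.
apply: le_integrable intb => //.
  apply/measurable_EFinP; apply: measurable_funX.
  by apply: measurable_funD; [apply: measurable_funD => //|]; exact: measurable_funM.
move=> z _; rewrite /= lee_fin ger0_norm ?sqr_ge0// ger0_norm.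
  have := sqr_ge0 (m - a * z.1); have := sqr_ge0 (m - b * z.2).
  by have := sqr_ge0 (a * z.1 - b * z.2); nra.
have := sqr_ge0 m; have := mulr_ge0 (sqr_ge0 a) (sqr_ge0 z.1).
by have := mulr_ge0 (sqr_ge0 b) (sqr_ge0 z.2); lra.
Qed.

Lemma integrable_mul_sqr (d : measure_display) (T : measurableType d)
    (P : {measure set T -> \bar R}) (X Y : T -> R) :
  measurable_fun setT X -> measurable_fun setT Y ->
  P.-integrable setT (fun w => (X w ^+ 2)%:E) ->
  P.-integrable setT (fun w => (Y w ^+ 2)%:E) ->
  P.-integrable setT (fun w => (X w * Y w)%:E).
Proof.
move=> mX mY X2 Y2; apply: le_integrable (integrableD _ X2 Y2) => //.
  by apply/measurable_EFinP; exact: measurable_funM.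
move=> w _; rewrite /= lee_fin normrM [leRHS]ger0_norm ?addr_ge0 ?sqr_ge0//.
rewrite -(real_normK (num_real (X w))) -(real_normK (num_real (Y w))).
have := sqr_ge0 (`|X w| - `|Y w|).
by have := mulr_ge0 (normr_ge0 (X w)) (normr_ge0 (Y w)); lra.
Qed.

(** The integral of a function that a reflection turns into its opposite equals
    its own opposite. *)
Lemma integral_reflect2_odd (p q : R) (f : R * R -> R) :
  p ^+ 2 + q ^+ 2 = 1 -> measurable_fun setT f ->
  N2.-integrable setT (EFin \o f) -> (forall z, f (reflect2 p q z) = - f z) ->
  (\int[N2]_z (f z)%:E = 0)%E.
Proof.
move=> pq1 mf intf odd_f.
have [_] := @same_law_integral _ _ _ _ _ _ R N2 N2 (reflect2 p q) id f
  (measurable_reflect2 p q) (@measurable_id _ _ _)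
  (fun B mB => normal_prob2_reflect2 pq1 mB) mf intf.
under eq_integral do rewrite odd_f EFinN.
rewrite integralN/=; last exact: integrable_add_def.
have : (\int[N2]_z (f z)%:E)%E \is a fin_num by exact: integrable_fin_num.
by case: (\int[N2]_z (f z)%:E)%E => // r _ [] rr; congr EFin; lra.
Qed.

End moments.

Section positivity.
Context {R : realType}.
Local Notation mu := (@lebesgue_measure R).
Local Notation N01 := (normal_prob (0 : R) 1).
Local Notation N2 := (N01 \x N01)%E.

Lemma normal01_itv_gt0 (x y : R) : x < y -> (0 < N01 `]x, y[%classic)%E.
Proof.
move=> xy; rewrite lt0e measure_ge0 andbT; apply/eqP => N0.
have : mu `]x, y[%classic = 0%E.
  apply: (@null_of_integral_pos_eq0 _ _ R mu `]x, y[%classic (normal_pdf 0 1)); last exact: N0.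
      exact: measurable_itv.
    exact: (measurable_funTS (measurable_normal_pdf 0 1)).
  move=> z _; rewrite normal_pdfE ?oner_neq0//.
  by rewrite mulr_gt0 ?expR_gt0 ?normal_peak_gt0 ?oner_neq0.
rewrite lebesgue_measure_itv/= lte_fin xy -EFinB => -[] /eqP.
by rewrite subr_eq0 gt_eqF.
Qed.

(** The strip contains a small square centred at the multiple of (a, b) on which
    the affine form equals (x + y) / 2. *)
Lemma normal_prob2_strip_gt0 (m a b x y : R) :
  0 < a ^+ 2 + b ^+ 2 -> x < y ->
  (0 < N2 [set z : R * R | (x < m + a * z.1 + b * z.2 < y)%R])%E.
Proof.
move=> s_gt0 xy; set S := [set z | _].
have mS : measurable S.
  have mf : measurable_fun setT (fun z : R * R => m + a * z.1 + b * z.2).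
    apply: measurable_funD; last exact: measurable_funM.
    by apply: measurable_funD => //; exact: measurable_funM.
  have -> : S = setT `&` (fun z : R * R => m + a * z.1 + b * z.2) @^-1` `]x, y[%classic.
    by apply/seteqP; split => z /=; rewrite in_itv/=; [|case].
  exact: mf.
pose k := ((x + y) / 2 - m) / (a ^+ 2 + b ^+ 2).
(* The extra 1 makes the bound on the deviation of the form strict. *)
pose e := (y - x) / 2 / (`|a| + `|b| + 1).
have D0 : 0 < `|a| + `|b| + 1 by rewrite ltr_wpDl// addr_ge0.
have e0 : 0 < e by rewrite !divr_gt0// subr_gt0.
pose J c := `]c - e, c + e[%classic : set R.
have J0 c : (0 < N01 (J c))%E by apply: normal01_itv_gt0; lra.
have JS : J (k * a) `*` J (k * b) `<=` S.
  move=> [u v] []; rewrite /J /= !in_itv/= -!lter_distl => hu hv.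
  have kE : k * (a ^+ 2 + b ^+ 2) = (x + y) / 2 - m by rewrite /k divfK// gt_eqF.
  have : `|a * (u - k * a) + b * (v - k * b)| < (y - x) / 2.
    have eE : (y - x) / 2 = (`|a| + `|b| + 1) * e.
      by rewrite /e mulrCA divff ?mulr1// gt_eqF.
    rewrite eE; apply: le_lt_trans (ler_normD _ _) _; rewrite !normrM.
    have := ler_wpM2l (normr_ge0 a) (ltW hu).
    have := ler_wpM2l (normr_ge0 b) (ltW hv); lra.
  by rewrite ltr_norml /S /= => /andP[h1 h2]; apply/andP; split; lra.
set A := J (k * a) in JS; set B := J (k * b) in JS.
apply: (@lt_le_trans _ _ (N2 (A `*` B))).
  have -> : N2 (A `*` B) = (N01 A * N01 B)%E.
    by apply: product_measure1E; exact: measurable_itv.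
  by apply: mule_gt0; exact: J0.
by apply: le_measure; rewrite ?inE//; apply: measurableX; exact: measurable_itv.
Qed.

End positivity.

(** * Linear regression for jointly normal variables *)

Section orthogonality.
Context {R : realType}.
Local Notation N01 := (normal_prob (0 : R) 1).
Local Notation N2 := (N01 \x N01)%E.

Lemma measurable_affine2 (m a b : R) :
  measurable_fun setT (fun z : R * R => m + a * z.1 + b * z.2).
Proof.
by apply: measurable_funD; [apply: measurable_funD => //|]; exact: measurable_funM.
Qed.

(** The reflection across the line spanned by (a, b): it fixes the linear form with
    coefficients (a, b) and negates the forms orthogonal to it. *)
Lemma exists_reflect2 (a b : R) : a ^+ 2 + b ^+ 2 != 0 ->
  exists p q : R, [/\ p ^+ 2 + q ^+ 2 = 1,
    forall z, a * (reflect2 p q z).1 + b * (reflect2 p q z).2 = a * z.1 + b * z.2 &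
    forall c d z, c * a + d * b = 0 ->
      c * (reflect2 p q z).1 + d * (reflect2 p q z).2 = - (c * z.1 + d * z.2)].
Proof.
set s := a ^+ 2 + b ^+ 2 => s0.
exists ((a ^+ 2 - b ^+ 2) / s), (2 * a * b / s); split.
- by rewrite /s; field.
- by move=> z; rewrite /reflect2; cbn [fst snd]; rewrite /s; field.
move=> c d z cd; rewrite /reflect2; cbn [fst snd].
apply/eqP; rewrite -subr_eq0 opprK; apply/eqP.
transitivity (2 * (c * a + d * b) * (a * z.1 + b * z.2) / s); last first.
  by rewrite cd mulr0 !mul0r.
by rewrite /s; field.
Qed.

(** In a standard normal vector a linear form is uncorrelated with the functions of
    an orthogonal form: the reflection of [exists_reflect2] leaves the factor h
    unchanged and negates the other one. *)
Lemma integral_orthogonal (m a b c d : R) (h : R -> R) :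
  a ^+ 2 + b ^+ 2 != 0 -> c * a + d * b = 0 -> measurable_fun setT h ->
  N2.-integrable setT
    (fun z : R * R => ((c * z.1 + d * z.2) * h (m + a * z.1 + b * z.2))%:E) ->
  (\int[N2]_z ((c * z.1 + d * z.2) * h (m + a * z.1 + b * z.2))%R%:E = 0)%E.
Proof.
move=> s0 cd mh intf; have [p [q [pq1 fix_ab odd_cd]]] := exists_reflect2 s0.
apply: (@integral_reflect2_odd R p q
  (fun z => (c * z.1 + d * z.2) * h (m + a * z.1 + b * z.2))) => //.
  apply: measurable_funM.
    by apply: measurable_funD; exact: measurable_funM.
  exact: measurableT_comp mh (measurable_affine2 _ _ _).
by move=> z; rewrite odd_cd// -!addrA fix_ab mulNr.
Qed.

Lemma integrable_affine2 (m a b : R) :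
  N2.-integrable setT (fun z : R * R => (m + a * z.1 + b * z.2)%:E).
Proof.
have := @integrable_mul_sqr R _ _ N2 (fun z => m + a * z.1 + b * z.2) (cst 1)
  (measurable_affine2 _ _ _) (measurable_cst _) (integrable_sqr_plane _ _ _).
have -> : (fun w : R * R => (cst 1 w ^+ 2)%:E) =
    (fun z : R * R => ((1 + 0 * z.1 + 0 * z.2) ^+ 2)%:E).
  by apply/funext => z /=; rewrite !mul0r !addr0.
move=> /(_ (integrable_sqr_plane _ _ _)); apply: eq_integrable => // z _.
by rewrite /= mulr1.
Qed.

Lemma integral_affine2 (m a b : R) :
  (\int[N2]_z (m + a * z.1 + b * z.2)%R%:E = m%:E)%E.
Proof.
have intl : N2.-integrable setT (fun z : R * R => (a * z.1 + b * z.2)%:E).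
  apply: eq_integrable (integrable_affine2 0 a b) => // z _.
  by rewrite /= add0r.
have intm : N2.-integrable setT (EFin \o (cst m : R * R -> R)).
  apply: eq_integrable (integrable_affine2 m 0 0) => // z _.
  by rewrite /= !mul0r !addr0.
have lin0 : (\int[N2]_z (a * z.1 + b * z.2)%R%:E = 0)%E.
  have [s0|s0] := eqVneq (a ^+ 2 + b ^+ 2) 0.
    have /andP[/eqP a0 /eqP b0] : (a == 0) && (b == 0).
      by rewrite -(sqrf_eq0 a) -(sqrf_eq0 b) -paddr_eq0 ?sqr_ge0// s0.
    rewrite -[RHS](integral0 N2 setT); apply: eq_integral => z _.
    by rewrite a0 b0 !mul0r addr0.
  (* The form with coefficients (a, b) is orthogonal to (-b, a). *)
  have s0' : (- b) ^+ 2 + a ^+ 2 != 0 by rewrite sqrrN addrC.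
  have ortho : a * - b + b * a = 0 by ring.
  rewrite -[RHS](@integral_orthogonal 0 _ _ _ _ (cst 1) s0' ortho (measurable_cst _)).
    by apply: eq_integral => z _; rewrite /= mulr1.
  by apply: eq_integrable intl => // z _; rewrite /= mulr1.
under eq_integral do rewrite -addrA EFinD.
rewrite (integralD_EFin _ intm intl)//= lin0 adde0.
by rewrite integral_cst// [X in (_ * X)%E]normal_prob2_setT mule1.
Qed.

End orthogonality.

(** In the plane, [V] is m2 plus the linear form (a21, a22), and removing from [U]
    its projection beta (V - m2) on that form leaves m1 plus an orthogonal linear
    form [W]; by [integral_orthogonal], [W] is orthogonal to every function of [V].
    Taking for this function V - m2 gives the covariance, and taking an indicator
    gives the conditional expectation of [U] given [V], in integrated form. *)
Lemma jointly_normal_regression (R : realType) (d : measure_display)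
    (T : measurableType d) (P : probability T R) (U V : T -> R) :
  jointly_normal P U V -> (0 < 'V_P[V])%E ->
  exists beta : R,
    [/\ P.-integrable setT (EFin \o U), P.-integrable setT (EFin \o V),
        covariance P U V = (beta%:E * 'V_P[V])%E,
        forall B, measurable B ->
          (\int[P]_(w in V @^-1` B) (U w)%:E =
           \int[P]_(w in V @^-1` B)
             (fine 'E_P[U] + beta * (V w - fine 'E_P[V]))%R%:E)%E &
        forall x y, x < y -> (0 < P (V @^-1` `]x, y[%classic))%E].
Proof.
move=> [mU mV [m1 [m2 [a11 [a12 [a21 [a22 law]]]]]]] varV_gt0.
pose A (z : R * R) := (m1 + a11 * z.1 + a12 * z.2, m2 + a21 * z.1 + a22 * z.2).
have mUV : measurable_fun setT (fun w => (U w, V w)) by exact: measurable_fun_pair.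
have mA : measurable_fun setT A.
  by apply: measurable_fun_pair; exact: measurable_affine2.
set N2 := (normal_prob 0 1 \x normal_prob 0 1)%E in law.
have transfer (f : R * R -> R) : measurable_fun setT f ->
    N2.-integrable setT (EFin \o (f \o A)) ->
    P.-integrable setT (EFin \o (f \o (fun w => (U w, V w)))) /\
    (\int[P]_w (f (U w, V w))%:E = \int[N2]_z (f (A z))%:E)%E.
  by move=> mf; apply: same_law_integral.
have [intU EU] := transfer fst (@measurable_fst _ _ _ _) (integrable_affine2 m1 a11 a12).
have [intV EV] := transfer snd (@measurable_snd _ _ _ _) (integrable_affine2 m2 a21 a22).
have {}EU : ('E_P[U] = m1%:E)%E by rewrite unlock EU integral_affine2.
have {}EV : ('E_P[V] = m2%:E)%E by rewrite unlock EV integral_affine2.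
have varE : ('V_P[V] = \int[P]_w ((V w - m2) * (V w - m2))%R%:E)%E.
  by rewrite /variance unlock EV /= unlock.
have covE : (covariance P U V = \int[P]_w ((U w - m1) * (V w - m2))%R%:E)%E.
  by rewrite unlock EU EV /= unlock.
have mV2 : measurable_fun setT (fun v : R => v - m2) by exact: measurable_funB.
have int2V : N2.-integrable setT
    (fun z => ((m2 + a21 * z.1 + a22 * z.2 - m2) ^+ 2)%:E).
  apply: eq_integrable (integrable_sqr_plane 0 a21 a22) => // z _ /=.
  by congr EFin; ring.
have [intVV varN2] : P.-integrable setT (fun w => ((V w - m2) * (V w - m2))%:E) /\
    (\int[P]_w ((V w - m2) * (V w - m2))%R%:E =
     \int[N2]_z ((m2 + a21 * z.1 + a22 * z.2 - m2) *
       (m2 + a21 * z.1 + a22 * z.2 - m2))%R%:E)%E.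
  apply: (transfer (fun x => (x.2 - m2) * (x.2 - m2))).
    by apply: measurable_funM; exact: measurableT_comp mV2 _.
  by apply: eq_integrable int2V => // z _ /=; rewrite expr2.
(* A vanishing form (a21, a22) would make the variance of V zero. *)
have s0 : a21 ^+ 2 + a22 ^+ 2 != 0.
  apply/negP => s0; move: varV_gt0; rewrite varE varN2.
  have /andP[/eqP a0 /eqP b0] : (a21 == 0) && (a22 == 0).
    by rewrite -(sqrf_eq0 a21) -(sqrf_eq0 a22) -paddr_eq0 ?sqr_ge0.
  rewrite (eq_integral (cst 0%E)) ?integral0 ?ltxx// => z _.
  by rewrite a0 b0 !mul0r !addr0 subrr mulr0.
have s_gt0 : 0 < a21 ^+ 2 + a22 ^+ 2 by rewrite lt0r s0 addr_ge0 ?sqr_ge0.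
pose beta := (a11 * a21 + a12 * a22) / (a21 ^+ 2 + a22 ^+ 2).
pose c := a11 - beta * a21; pose e := a12 - beta * a22.
have ce : c * a21 + e * a22 = 0 by rewrite /c /e /beta; field.
pose W w := U w - m1 - beta * (V w - m2).
have residual_orth (h : R -> R) : measurable_fun setT h ->
    N2.-integrable setT (fun z => (h (m2 + a21 * z.1 + a22 * z.2) ^+ 2)%:E) ->
    P.-integrable setT (fun w => (W w * h (V w))%:E) /\
    (\int[P]_w (W w * h (V w))%R%:E = 0)%E.
  move=> mh inth.
  have mhV : measurable_fun setT (fun z : R * R => h (m2 + a21 * z.1 + a22 * z.2)).
    exact: measurableT_comp mh (measurable_affine2 _ _ _).
  have mce : measurable_fun setT (fun z : R * R => c * z.1 + e * z.2).
    by apply: measurable_funD; exact: measurable_funM.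
  have intce : N2.-integrable setT (fun z : R * R => ((c * z.1 + e * z.2) ^+ 2)%:E).
    by apply: eq_integrable (integrable_sqr_plane 0 c e) => // z _ /=; rewrite add0r.
  have intceh := @integrable_mul_sqr R _ _ N2 _ _ mce mhV intce inth.
  have WA z : (A z).1 - m1 - beta * ((A z).2 - m2) = c * z.1 + e * z.2.
    by rewrite /A /c /e; cbn [fst snd]; ring.
  have [||intW ->] := transfer (fun x => (x.1 - m1 - beta * (x.2 - m2)) * h x.2).
  - apply: measurable_funM; last exact: measurableT_comp mh _.
    apply: measurable_funB; first exact: measurable_funB.
    by apply: measurable_funM => //; exact: measurable_funB.
  - by apply: eq_integrable intceh => // z _; rewrite /= -WA.
  split=> //; rewrite -[RHS](@integral_orthogonal R m2 _ _ _ _ h s0 ce mh intceh).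
  by apply: eq_integral => z _; rewrite WA.
exists beta; split => //.
- have [intWV WV0] := residual_orth _ mV2 int2V.
  rewrite covE varE -(integralZl measurableT intVV).
  rewrite -[RHS]add0e -WV0 -integralD//; last exact: integrableZl.
  by apply: eq_integral => w _; rewrite -EFinM -EFinD /W; congr EFin; ring.
- move=> B mB; rewrite EU EV /=.
  have mVB : measurable (V @^-1` B) by rewrite -[X in measurable X]setTI; exact: mV.
  have intreg : P.-integrable setT (EFin \o (fun w => m1 + beta * (V w - m2))).
    have [] := transfer (fun x => m1 + beta * (x.2 - m2)).
    - apply: measurable_funD => //; apply: measurable_funM => //.
      exact: measurable_funB.
    - apply: eq_integrable (integrable_affine2 m1 (beta * a21) (beta * a22)) => //.
      by move=> z _ /=; congr EFin; ring.
    by [].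
  have intW : P.-integrable setT (EFin \o W).
    apply: eq_integrable (integrableB measurableT intU intreg) => // w _ /=.
    by rewrite -EFinB /W; congr EFin; ring.
  have [||_ W0] := residual_orth (\1_B).
  - exact: measurable_indic.
  (* The constant 1 dominates the squared indicator. *)
  - apply: (le_integrable _ _ _ (integrable_sqr_plane 1 0 0)) => //.
      apply/measurable_EFinP; apply: measurable_funX.
      exact: measurableT_comp (measurable_indic mB) (measurable_affine2 _ _ _).
    move=> z _; rewrite /= !mul0r !addr0 expr1n normr1 lee_fin indicE.
    by case: (_ \in _); rewrite ?expr1n ?expr0n ?normr1 ?normr0.
  have WB0 : (\int[P]_(w in V @^-1` B) (W w)%:E = 0)%E.
    rewrite integral_mkcond -[RHS]W0; apply: eq_integral => w _.
    rewrite patchE indicE -(_ : (w \in V @^-1` B) = (V w \in B)).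
      by case: ifPn; rewrite ?mulr1 ?mulr0.
    by rewrite /in_mem/=; apply/asboolP/asboolP.
  transitivity (\int[P]_(w in V @^-1` B)
      ((m1 + beta * (V w - m2))%:E + (W w)%:E))%E.
    by apply: eq_integral => w _; rewrite -EFinD /W; congr EFin; ring.
  rewrite integralD_EFin//; [|exact: integrableS intreg|exact: integrableS intW].
  by rewrite WB0 adde0.
move=> x y xy.
have -> : P (V @^-1` `]x, y[%classic) = P [set w | ((snd @^-1` `]x, y[%classic) (U w, V w))].
  by [].
rewrite law; last first.
  by rewrite -[X in measurable X]setTI; exact: measurable_snd.
have := normal_prob2_strip_gt0 m2 s_gt0 xy.
by congr (0 < N2 _)%E; apply/seteqP; split => z /=; rewrite in_itv/=.
Qed.

(** * Pricing *)

(** If g were nonzero at z0, it would keep a strict sign on an interval around z0,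
    and its integral over the event that V falls there could not vanish, this event
    having positive probability. *)
Lemma continuous_eq0_of_integral_eq0 (R : realType) (d : measure_display)
    (T : measurableType d) (P : probability T R) (V : T -> R) (g : R -> R)
    (z0 : R) :
  measurable_fun setT V -> measurable_fun setT g ->
  P.-integrable setT (EFin \o (g \o V)) ->
  (forall x y, x < y -> (0 < P (V @^-1` `]x, y[%classic))%E) ->
  (forall x y, x < y ->
    (\int[P]_(w in V @^-1` `]x, y[%classic) (g (V w))%:E = 0)%E) ->
  {for z0, continuous g} -> g z0 = 0.
Proof.
move=> mV mg intg pos int0 cg.
have g_le0 (h : R -> R) : measurable_fun setT h ->
    (forall x y, x < y ->
      (\int[P]_(w in V @^-1` `]x, y[%classic) (h (V w))%:E = 0)%E) ->
    {for z0, continuous h} -> h z0 <= 0.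
  move=> mh inth ch; rewrite leNgt; apply/negP => hz0.
  have /nbhs_ballP[r /= r0 hr] : \forall z \near z0, 0 < h z by exact: (cvgr_gt (h z0) ch).
  have xy : z0 - r < z0 + r by lra.
  have := pos _ _ xy; rewrite (_ : P _ = 0%E) ?ltxx//.
  apply: (null_of_integral_pos_eq0 _ _ _ (inth _ _ xy)).
  - by rewrite -[X in measurable X]setTI; exact: mV.
  - by apply: measurable_funTS; exact: measurableT_comp mh mV.
  - move=> w /=; rewrite in_itv/= -ltr_distl => hw; apply: hr.
    by rewrite /ball/= distrC.
apply/eqP; rewrite eq_le; apply/andP; split; first exact: g_le0.
rewrite -oppr_le0; apply: (g_le0 (fun z => - g z)).
- exact: measurableT_comp.
- move=> x y xy; under eq_integral do rewrite EFinN.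
  have mI : measurable (V @^-1` `]x, y[%classic).
    by rewrite -[X in measurable X]setTI; exact: mV.
  rewrite integralN ?int0 ?oppe0//; apply: integrable_add_def => //.
  exact: (integrableS measurableT mI (subsetT _) intg).
- exact: cvgN.
Qed.

(** The margin is restricted to be positive, so a maximizer exists only when the
    vertex of the parabola lies at a positive margin: otherwise the supremum 0 is
    approached as the margin tends to 0 and not attained. *)
Lemma argmax_concave_quadratic (R : realType) (c alpha kappa x : R) :
  kappa < 0 ->
  is_argmax (feasible c) (fun z => (z - c) * (alpha + kappa * (z - c))) x ->
  0 < alpha /\ x - c = - alpha / (2 * kappa).
Proof.
move=> k0 [cx max]; rewrite /feasible/= in cx.
have {}max t : 0 < t ->
    t * (alpha + kappa * t) <= (x - c) * (alpha + kappa * (x - c)).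
  by move=> t0; have := max (t + c); rewrite /feasible/= addrK ltrDr; apply.
have {cx} u0 : 0 < x - c by rewrite subr_gt0.
move: (x - c) u0 max => u u0 max.
(* Halving the margin u does not increase the revenue. *)
have alpha0 : 0 < alpha.
  have : 0 <= u * (alpha / 2 + 3 / 4 * (kappa * u)).
    have u2 : 0 < u / 2 by rewrite divr_gt0.
    by have := max _ u2; lra.
  rewrite pmulr_rge0//; have : kappa * u < 0 by rewrite nmulr_rlt0.
  lra.
have t0 : 0 < - alpha / (2 * kappa) by rewrite ltr_ndivlMr; lra.
split=> //; have := max _ t0; rewrite -subr_ge0.
have -> : u * (alpha + kappa * u) - - alpha / (2 * kappa) *
    (alpha + kappa * (- alpha / (2 * kappa))) =
    kappa * (u - - alpha / (2 * kappa)) ^+ 2.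
  by field; rewrite lt_eqF.
rewrite nmulr_rge0// => h; apply/eqP; rewrite -subr_eq0 -sqrf_eq0.
by rewrite eq_le h sqr_ge0.
Qed.

(** Doubling and halving the margin would otherwise improve on any candidate. *)
Lemma argmax_linear_eq0 (R : realType) (c alpha x : R) :
  is_argmax (feasible c) (fun z => (z - c) * alpha) x -> alpha = 0.
Proof.
move=> [cx max]; rewrite /feasible/= in cx.
have u0 : 0 < x - c by rewrite subr_gt0.
have half : 0 < (x - c) / 2 by rewrite divr_gt0.
have := max (c + (x - c) / 2); have := max (c + ((x - c) + (x - c))).
rewrite /feasible/= !ltrDl => /(_ (addr_gt0 u0 u0)) h1 /(_ half) h2.
suff /eqP : (x - c) * alpha = 0 by rewrite mulf_eq0 gt_eqF//= => /eqP.
by lra.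
Qed.

Lemma sup_affine_nonincreasing (R : realType) (c a b : R) : b <= 0 ->
  sup [set a + b * z | z in feasible c] = a + b * c.
Proof.
move=> b0; set S := image _ _.
have ubS : ubound S (a + b * c).
  by move=> _ [z /= cz <-]; rewrite /feasible/= in cz; nra.
have S0 : S !=set0 by exists (a + b * (c + 1)), (c + 1) => //; rewrite /feasible/= ltrDl.
apply/eqP; rewrite eq_le; apply/andP; split; first exact: ge_sup.
rewrite leNgt; apply/negP => lt_sup.
have inS t : 0 < t -> a + b * (c + t) <= sup S.
  move=> t0; apply: ub_le_sup; first by exists (a + b * c).
  by exists (c + t) => //; rewrite /feasible/= ltrDl.
have [b0'|b_neq0] := eqVneq b 0; first by have := inS 1 ltr01; rewrite b0' in lt_sup *; lra.
have bn : b < 0 by rewrite lt_neqAle b_neq0.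
(* The margin at which the demand is midway between sup S and a + b c. *)
have tpos : 0 < (sup S - (a + b * c)) / (2 * b).
  by rewrite ltr_ndivlMr; lra.
have := inS _ tpos.
have -> : a + b * (c + (sup S - (a + b * c)) / (2 * b)) = (a + b * c + sup S) / 2.
  by field; rewrite lt_eqF.
lra.
Qed.

(** At a margin u the ratio of revenues is 1 - ((y0 + 2 b u) / y0)^2, and at the
    predictive margin y0 + 2 b u = beta / (b + beta) * (y0 + b m).  Here m stands
    for the mean margin, so that y0 + b m is the mean observed demand. *)
Lemma linear_revenue_ratio (R : realFieldType) (y0 b beta m u : R) :
  0 < y0 -> b < 0 -> beta <= 0 ->
  u = - (y0 - beta * m) / (2 * (b + beta)) ->
  u * (y0 + b * u) / (- y0 / (2 * b) * (y0 + b * (- y0 / (2 * b)))) =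
  1 - (beta / (b + beta) * ((y0 + b * m) / y0)) ^+ 2.
Proof.
move=> y0_gt0 b_lt0 beta_le0 ->; field.
have slope_lt0 : b + beta < 0 by lra.
by rewrite gt_eqF// !lt_eqF.
Qed.

Theorem theorem3 (R : realType) (d : measure_display) (T : measurableType d)
    (P : probability T R) (c : R) (Y : R -> {RV P >-> R}) (Z : {RV P >-> R})
    (ytilde : R -> R) (zstar ztilde : R)
    (c_gt0 : 0 < c)
    (Y_integrable : forall z, P.-integrable setT (EFin \o Y z))
    (observed_measurable : measurable_fun setT (observed_demand Y Z))
    (y_linear : affine_fun (mean_demand Y))
    (y_nonincreasing : {homo mean_demand Y : u v / u <= v >-> v <= u})
    (market_size_neq0 : market_size Y c != 0)
    (eps_Z_normal : jointly_normal P (residual Y Z) Z)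
    (eps_centered : ('E_P[residual Y Z] = 0)%E)
    (Z_nondegenerate : (0 < 'V_P[Z])%E)
    (eps_Z_corr : (covariance P (residual Y Z) Z <= 0)%E)
    (ytilde_version : cond_expectation_version (observed_demand Y Z) Z ytilde)
    (ytilde_continuous : forall z, feasible c z -> {for z, continuous ytilde})
    (zstar_opt : is_argmax (feasible c) (revenue c (mean_demand Y)) zstar)
    (ztilde_opt : is_argmax (feasible c) (revenue c ytilde) ztilde) :
  1 - (fine 'E_P[observed_demand Y Z] / market_size Y c) ^+ 2
    <= revenue c (mean_demand Y) ztilde / revenue c (mean_demand Y) zstar
  /\ revenue c (mean_demand Y) ztilde / revenue c (mean_demand Y) zstar <= 1.
Proof.
have [a [b yE]] := y_linear.
have {y_linear} y_fun : mean_demand Y = (fun z => a + b * z) by apply/funext.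
have b_le0 : b <= 0 by have := y_nonincreasing 0 1 ler01; rewrite !yE; lra.
pose y0 := a + b * c.
have sizeE : market_size Y c = y0.
  by rewrite /market_size y_fun sup_affine_nonincreasing.
have R_E z : revenue c (mean_demand Y) z = (z - c) * (y0 + b * (z - c)).
  by rewrite /revenue yE /y0; ring.
(* A flat demand curve has an optimal price only if it vanishes, and then so does
   the market size. *)
have b_lt0 : b < 0.
  rewrite lt_neqAle b_le0 andbT; apply/eqP => b0; move/eqP : market_size_neq0.
  rewrite sizeE; apply; apply: (@argmax_linear_eq0 _ c _ zstar).
  by move: zstar_opt; congr (is_argmax _ _ _); apply/funext => z; rewrite R_E b0; ring.
have [y0_gt0 zstarE] : 0 < y0 /\ zstar - c = - y0 / (2 * b).
  apply: argmax_concave_quadratic => //.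
  by move: zstar_opt; congr (is_argmax _ _ _); apply/funext => z; rewrite R_E.
have [beta [int_eps int_Z covE regression Z_full]] :=
  jointly_normal_regression eps_Z_normal Z_nondegenerate.
have beta_le0 : beta <= 0.
  rewrite leNgt; apply/negP => beta_gt0; move: eps_Z_corr; rewrite covE.
  by rewrite leNgt mule_gt0.
pose m := fine 'E_P[Z].
have [mytilde int_ytilde ytildeE] := ytilde_version.
have obsE w : observed_demand Y Z w = residual Y Z w + (a + b * Z w).
  by rewrite /residual yE subrK.
have int_affine p q : P.-integrable setT (EFin \o (fun w => p + q * Z w)).
  have intp : P.-integrable setT (EFin \o cst p).
    exact: finite_measure_integrable_cst.
  have := integrableD measurableT intp (integrableZl measurableT q int_Z).
  by apply: eq_integrable.
have integral_affine : (\int[P]_w (a + b * Z w)%R%:E = (a + b * m)%:E)%E.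
  have intp : P.-integrable setT (EFin \o cst a).
    exact: finite_measure_integrable_cst.
  have intq := integrableZl measurableT b int_Z.
  have mE : (\int[P]_w (Z w)%:E = m%:E)%E.
    by rewrite /m unlock fineK//; exact: integrable_fin_num int_Z.
  transitivity (\int[P]_w ((cst a w)%:E + b%:E * (Z w)%:E))%E.
    by apply: eq_integral => w _; rewrite EFinD EFinM.
  rewrite (integralD measurableT intp intq)/= integralZl// mE.
  by rewrite integral_cst//= probability_setT mule1.
have E_obs : fine 'E_P[observed_demand Y Z] = a + b * m.
  rewrite unlock; under eq_integral do rewrite obsE.
  rewrite (integralD_EFin measurableT int_eps (int_affine a b)).
  by have := eps_centered; rewrite unlock /= => ->; rewrite integral_affine add0e.
pose lin z := a + b * z + beta * (z - m).
have mlin : measurable_fun setT lin.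
  apply: measurable_funD; last by apply: measurable_funM => //; exact: measurable_funB.
  by apply: measurable_funD => //; exact: measurable_funM.
have int_lin : P.-integrable setT (EFin \o (lin \o Z)).
  apply: eq_integrable (int_affine (a - beta * m) (b + beta)) => // w _.
  by rewrite /= /lin; congr EFin; ring.
have cond_lin B : measurable B ->
    (\int[P]_(w in Z @^-1` B) (ytilde (Z w))%:E =
     \int[P]_(w in Z @^-1` B) (lin (Z w))%:E)%E.
  move=> mB; have mZB : measurable (Z @^-1` B).
    by rewrite -[X in measurable X]setTI; exact: measurable_funP.
  rewrite -ytildeE//; under eq_integral do rewrite obsE.
  have int_y := integrableS measurableT mZB (subsetT _) (int_affine a b).
  have int_epsB := integrableS measurableT mZB (subsetT _) int_eps.
  have int_reg := integrableS measurableT mZB (subsetT _)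
    (int_affine (- (beta * m)) beta).
  rewrite (integralD_EFin mZB int_epsB int_y) regression// eps_centered/=.
  rewrite -/m (eq_integral (fun w => (- (beta * m) + beta * Z w)%:E)); last first.
    by move=> w _; congr EFin; ring.
  rewrite -(integralD_EFin mZB int_reg int_y); apply: eq_integral => w _.
  by rewrite /= -EFinD /lin; congr EFin; ring.
(* Both curves integrate alike over every event on Z; continuity beyond c turns
   this into an equality at each feasible price. *)
have ytilde_lin z : c < z -> ytilde z = lin z.
  move=> cz; apply/eqP; rewrite -subr_eq0; apply/eqP.
  pose g z := ytilde z - lin z.
  have mg : measurable_fun setT g by exact: measurable_funB.
  have int_g : P.-integrable setT (EFin \o (g \o Z)).
    exact: (integrableB measurableT int_ytilde int_lin).
  have mZ : measurable_fun setT Z by [].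
  apply: (continuous_eq0_of_integral_eq0 mZ mg int_g) => //.
    move=> x y xy; have mI : measurable (Z @^-1` `]x, y[%classic).
      by rewrite -[X in measurable X]setTI; exact: measurable_funP.
    have int_yt := integrableS measurableT mI (subsetT _) int_ytilde.
    have int_l := integrableS measurableT mI (subsetT _) int_lin.
    under eq_integral do rewrite EFinB.
    rewrite (integralB_EFin mI int_yt int_l) cond_lin// subee//.
    exact: integrable_fin_num.
  apply: cvgB; first exact: ytilde_continuous.
  apply: cvgD; last first.
    by apply: cvgM; [|apply: cvgB; [exact: cvg_id|]]; exact: cvg_cst.
  by apply: cvgD; [exact: cvg_cst|apply: cvgM; [exact: cvg_cst|exact: cvg_id]].
have [_ ztildeE] : 0 < y0 - beta * (m - c) /\
    ztilde - c = - (y0 - beta * (m - c)) / (2 * (b + beta)).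
  apply: argmax_concave_quadratic; first lra.
  have Rt z : c < z -> revenue c ytilde z =
      (z - c) * (y0 - beta * (m - c) + (b + beta) * (z - c)).
    by move=> cz; rewrite /revenue ytilde_lin// /lin /y0; ring.
  have [cz max] := ztilde_opt; split=> // u cu.
  by rewrite -!Rt//; exact: max.
rewrite E_obs sizeE !R_E zstarE (linear_revenue_ratio y0_gt0 b_lt0 beta_le0 ztildeE).
have -> : a + b * m = y0 + b * (m - c) by rewrite /y0; ring.
have slope_lt0 : b + beta < 0 by lra.
split; last by rewrite gerBl sqr_ge0.
rewrite lerD2l lerN2 exprMn ler_piMl ?sqr_ge0// expr_le1//.
  by rewrite ler_ndivrMr// mul1r; lra.
by rewrite mulr_le0// invr_le0 ltW.
Qed.
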